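(* For all integers $r\geq 2$, $\frac{r^2}{2}< \hat{R}_r(P_{4})\leq (r+1)(2r+1)$.
   Context: $P_4$ is the graph path on $4$ vertices. For graphs $G,H$, $G\to_r H$ means every $r$-coloring of the edges of $G$ contains a monochromatic copy of $H$; $\hat R_r(H)$ is the minimum number of edges of a graph $G$ with $G\to_r H$. *)

(* Defs.v *)
From mathcomp Require Import all_boot.
From mathcomp Require Import boolp.
From mathcomp Require classical_sets.

Set Implicit Arguments.
Unset Strict Implicit.
Unset Printing Implicit Defensive.

Local Open Scope nat_scope.

Record sgraph := SGraph {
  vertex :> finType;
  adj : rel vertex;
  adj_sym : symmetric adj;
  adj_irrefl : irreflexive adj
}.

Definition edges (G : sgraph) : {set {set G}} :=
  [set [set x; y] | x in [set: G], y in [set: G] & adj x y].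

Definition path_adj (n : nat) : rel 'I_n :=
  fun i j => (i.+1 == j) || (j.+1 == i).

Lemma path_adj_sym n : symmetric (@path_adj n).
Proof. by move=> i j; rewrite /path_adj orbC. Qed.

Lemma path_adj_irrefl n : irreflexive (@path_adj n).
Proof. by move=> i; rewrite /path_adj orbb -[X in _ == X]addn0 -addn1 eqn_add2l. Qed.

(* The path on [n] vertices (so with [n.-1] edges). *)
Definition path_graph (n : nat) : sgraph :=
  SGraph (@path_adj_sym n) (@path_adj_irrefl n).

(* Colors are the naturals below [r]; the values of [c] outside [edges G]
   are irrelevant. *)
Definition edge_coloring (r : nat) (G : sgraph) (c : {set G} -> nat) : Prop :=
  forall e, e \in edges G -> c e < r.

(* A copy of [H] is a not necessarily induced subgraph isomorphic to [H]. *)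
Definition mono_copy (G H : sgraph) (c : {set G} -> nat) : Prop :=
  exists (f : H -> G) (k : nat),
    injective f /\
    forall x y : H, adj x y -> adj (f x) (f y) /\ c [set f x; f y] = k.

Definition arrows (r : nat) (G H : sgraph) : Prop :=
  forall c : {set G} -> nat, edge_coloring r c -> mono_copy H c.

Definition is_size_ramsey (r : nat) (H : sgraph) (m : nat) : Prop :=
  (exists G : sgraph, arrows r G H /\ #|edges G| = m) /\
  (forall G : sgraph, arrows r G H -> m <= #|edges G|).

(* [classical_sets.xget] returns the number satisfying [is_size_ramsey r H], which exists as
   soon as some graph arrows [H] (see [size_ramseyP]); its default value 0 is
   used only if there is no such graph. *)
Definition size_ramsey (r : nat) (H : sgraph) : nat :=
  classical_sets.xget 0 (is_size_ramsey r H).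

Lemma size_ramseyP (r : nat) (G H : sgraph) :
  arrows r G H -> is_size_ramsey r H (size_ramsey r H).
Proof.
move=> arr.
pose P m := `[< exists G0 : sgraph, arrows r G0 H /\ #|edges G0| = m >].
have exP : exists m, P m by exists #|edges G|; apply/asboolP; exists G.
case: (ex_minnP exP) => m /asboolP Pm minm.
suff: is_size_ramsey r H m by move=> Hm; exact: (classical_sets.xgetI 0 Hm).
by split=> // G0 arr0; apply: minm; apply/asboolP; exists G0.
Qed.

(* Main.v *)
(** Lower bound: a graph all of whose degrees are at most [r] is a union of [r]
    star forests, by adding the vertices one at a time and giving the edge from
    the new vertex [v] to an old neighbour [u] any colour not yet used at [u]:
    the new edges of a given colour then form a star centred at [v] that is a
    whole component of its colour class. A vertex of degree larger than [r] is
    removed by giving its star a private colour, which costs one colour and at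
    least [r + 1] edges; the hypothesis [2m <= r^2] passes to [r - 1].

    Upper bound: in a [P_4]-free graph every edge [xy] has
    [1 / d(x) + 1 / d(y) >= 1], so such a graph on [n] vertices has at most [n]
    edges, and [r] of them cannot cover the complete graph on [2r + 2]
    vertices. *)
Require Import Defs.
From mathcomp Require Import all_boot all_order all_algebra.
From mathcomp Require Import boolp zify.

Import Order.TTheory GRing.Theory Num.Theory.
Local Open Scope ring_scope.

(** * Colourings into star forests and the lower bound *)

Definition nbrs (G : sgraph) (A : {set G}) (x : G) : {set G} :=
  [set y in A | adj x y].

(* The endpoints [a] and [d] may coincide, so monochromatic triangles are
   excluded as well: every colour class is a star forest. *)
Definition star_coloring (G : sgraph) (A : {set G}) (r : nat)
    (c : {set G} -> nat) : Prop :=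
  (forall x y, x \in A -> y \in A -> adj x y -> (c [set x; y] < r)%N) /\
  (forall a x y b, a \in A -> x \in A -> y \in A -> b \in A ->
     adj a x -> adj x y -> adj y b -> a != y -> x != b ->
     c [set a; x] = c [set x; y] -> c [set x; y] <> c [set y; b]).

Lemma adj_neq (G : sgraph) (x y : G) : adj x y -> x != y.
Proof. by apply: contraTneq => ->; rewrite adj_irrefl. Qed.

Lemma exists_color_notin (r : nat) (s : seq nat) :
  (size s < r)%N -> exists2 k, (k < r)%N & k \notin s.
Proof.
move=> lt_s.
have [/allP sub|/allPn[k]] := boolP (all (mem s) (iota 0 r)).
  have := uniq_leq_size (iota_uniq 0 r) sub.
  by rewrite size_iota leqNgt lt_s.
by rewrite mem_iota => /= ltk nk; exists k.
Qed.

(** Here [g u] is the colour of the new edge [vu]. In a forbidden walk [a x y b] through [v], some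
    edge [vu] is followed or preceded by an edge [uw] avoiding [v], and [g_new] makes their colours
    differ. *)
Lemma star_coloring_extend {G : sgraph} {A : {set G}} {v : G} {r : nat}
    {c : {set G} -> nat} (g : G -> nat) :
  star_coloring G (A :\ v) r c ->
  (forall u, u \in A :\ v -> adj v u -> (g u < r)%N) ->
  (forall u w, u \in A :\ v -> w \in A :\ v -> adj v u -> adj u w ->
     c [set u; w] != g u) ->
  exists c', star_coloring G A r c'.
Proof.
move=> [c_lt c_star] g_lt g_new.
(* The other endpoint of an edge at [v] is recovered as the only element of [e :\ v]; among edges,
   the default 0 never occurs. *)
pose c' (e : {set G}) :=
  if v \in e then (if [pick u in e :\ v] is Some u then g u else 0%N) else c e.
have c'v u : u != v -> c' [set v; u] = g u.
  move=> uv; rewrite /c' set21.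
  case: pickP => [w|/(_ u)]; last by rewrite !inE eqxx orbT uv.
  by rewrite !inE => /andP[/negPf ->] /= /eqP ->.
have c'vr u : u != v -> c' [set u; v] = g u by move=> uv; rewrite setUC c'v.
have c'old x y : x != v -> y != v -> c' [set x; y] = c [set x; y].
  by move=> xv yv; rewrite /c' !inE ![v == _]eq_sym (negPf xv) (negPf yv).
exists c'; split=> [x y xA yA xy|a x y b aA xA yA bA ax xy yb ay xb].
  have [xv|xv] := eqVneq x v.
    subst x; have yv : y != v by rewrite eq_sym adj_neq.
    by rewrite c'v // g_lt // !inE yv.
  have [yv|yv] := eqVneq y v.
    by subst y; rewrite c'vr // g_lt // ?inE ?xv // adj_sym.
  by rewrite c'old // c_lt // !inE ?xv ?yv.
have [av|av] := eqVneq a v.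
  subst a; have xv : x != v by rewrite eq_sym adj_neq.
  have yv : y != v by rewrite eq_sym.
  rewrite c'v // c'old // => E.
  by have := g_new x y; rewrite !inE xv yv E eqxx => /(_ xA yA ax xy).
have [xv|xv] := eqVneq x v.
  subst x; have yv : y != v by rewrite eq_sym adj_neq.
  have bv : b != v by rewrite eq_sym.
  rewrite (c'v y) // (c'old y b) // => _ E.
  by have := g_new y b; rewrite !inE bv yv E eqxx => /(_ yA bA xy yb).
have [yv|yv] := eqVneq y v.
  subst y; rewrite c'old // c'vr // => E.
  have := g_new x a; rewrite !inE av xv setUC E eqxx adj_sym.
  by move=> /(_ xA aA xy); rewrite adj_sym => /(_ ax).
have [bv|bv] := eqVneq b v.
  subst b; rewrite (c'old x y) // c'vr // => _ E.
  have := g_new y x; rewrite !inE xv yv setUC E eqxx adj_sym.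
  by move=> /(_ yA xA yb); rewrite adj_sym => /(_ xy).
by rewrite !c'old //; apply: c_star; rewrite // !inE ?av ?xv ?yv ?bv.
Qed.

Lemma card_nbrsD1 (G : sgraph) (A : {set G}) (v x : G) :
  v \in A -> #|nbrs G A x| = (adj x v + #|nbrs G (A :\ v) x|)%N.
Proof.
move=> vA; rewrite (cardsD1 v) inE vA /=; congr (_ + _)%N.
by apply: eq_card => y; rewrite !inE andbA.
Qed.

Lemma sum_nbrsD1 (G : sgraph) (A : {set G}) (v : G) : v \in A ->
  (\sum_(x in A) #|nbrs G A x| =
   2 * #|nbrs G A v| + \sum_(x in A :\ v) #|nbrs G (A :\ v) x|)%N.
Proof.
move=> vA; rewrite (bigD1 v) //= mul2n -addnn -addnA; congr (_ + _)%N.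
under eq_bigr do rewrite (card_nbrsD1 _ _ _ _ vA).
rewrite big_split /=; congr (_ + _)%N; last first.
  by apply: eq_bigl => x; rewrite !inE andbC.
rewrite -sum1_card big_mkcond [RHS]big_mkcond; apply: eq_bigr => x _.
rewrite !inE adj_sym; case: (x \in A) => //=.
by case: eqVneq => [->|_]; rewrite ?adj_irrefl //=; case: (adj v x).
Qed.

(** The disjunction lets one induction on [#|A|] cover both ways of deleting a vertex: the degree
    bound survives with the same [r], and the bound on the degree sum, twice the number of edges
    inside [A], passes to [r - 1]. *)
Lemma star_coloring_exists (G : sgraph) (r : nat) (A : {set G}) :
  (forall x, x \in A -> (#|nbrs G A x| <= r)%N) \/
  (\sum_(x in A) #|nbrs G A x| <= r ^ 2)%N ->
  exists c, star_coloring G A r c.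
Proof.
move: {2}#|A| (erefl #|A|) => n; elim: n r A => [|n IHn] r A cardA degA.
  have A0 x : x \in A = false by rewrite (cards0_eq cardA) inE.
  by exists (fun=> 0%N); split=> [x y|a x y b]; rewrite A0.
have cardD v : v \in A -> #|A :\ v| = n.
  by move=> vA; apply/eqP; rewrite -eqSS -cardA (cardsD1 v A) vA.
have [/forallP deg_le|/forallPn[v]] :=
    boolP [forall x, (x \in A) ==> (#|nbrs G A x| <= r)%N].
  have {}deg_le x : x \in A -> (#|nbrs G A x| <= r)%N by apply/implyP.
  have [v vA] : exists v, v \in A by apply/card_gt0P; rewrite cardA.
  have [||c c_star] := IHn r (A :\ v); first exact: cardD.
    left=> x /setD1P[_ xA]; apply: leq_trans (deg_le x xA).
    by rewrite (card_nbrsD1 _ _ _ _ vA) leq_addl.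
  pose s u := [seq c [set u; w] | w <- enum (nbrs G (A :\ v) u)].
  (* Since [v] takes up one of the at most [r] neighbours of [u], fewer than [r] colours are already
     used at [u]. *)
  have free u : exists k, u \in A :\ v -> adj v u -> (k < r)%N /\ k \notin s u.
    have [/andP[/setD1P[_ uA] vu]|/negP nu] := boolP ((u \in A :\ v) && adj v u).
      have [|k ltk nk] := exists_color_notin r (s u); last by exists k.
      rewrite size_map -cardE; apply: leq_trans (deg_le u uA).
      by rewrite (card_nbrsD1 _ _ _ _ vA) adj_sym vu.
    by exists 0%N => uA vu; case: nu; rewrite uA.
  have [g gP] := choice free.
  apply: (star_coloring_extend g c_star) => [u uA /(gP u uA)[]//|u w uA wA vu uw].
  have [_] := gP u uA vu; apply: contraNneq => <-.
  by apply: map_f; rewrite mem_enum inE wA.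
rewrite negb_imply -ltnNge => /andP[vA deg_gt].
case: degA => [/(_ v vA)|]; first by rewrite leqNgt deg_gt.
rewrite (sum_nbrsD1 _ _ _ vA) => sum_le.
(* From here [r] is one less than before: the degree sum drops by at least [2 * (r + 2)], more than
   [(r + 1) ^ 2 - r ^ 2]. *)
case: r deg_gt sum_le => [|r] deg_gt sum_le; first by lia.
have [||c c_star] := IHn r (A :\ v); [exact: cardD|by right; nia|].
(* The colour [r] is fresh, as [c] uses only colours below [r]. *)
apply: (@star_coloring_extend _ _ v _ c (fun=> r)) => // [|u w uA wA _ uw].
  by case: c_star => c_lt ?; split=> // x y *; rewrite ltnS ltnW // c_lt.
by case: c_star => /(_ u w uA wA uw) /ltn_eqF ->.
Qed.

(** Double counting of incidences: the neighbours of [x] inject into the edges containing [x], and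
    an edge has at most two elements. *)
Lemma sum_degree_le (G : sgraph) :
  (\sum_x #|nbrs G setT x| <= 2 * #|edges G|)%N.
Proof.
have deg_le x : (#|nbrs G setT x| <= #|[set e in edges G | x \in e]|)%N.
  have inj : {in nbrs G setT x &, injective (fun y => [set x; y])}.
    move=> y z; rewrite !inE => /adj_neq xy /adj_neq xz E.
    have : y \in [set x; z] by rewrite -E set22.
    by rewrite !inE eq_sym (negPf xy) => /eqP.
  rewrite -(card_in_imset inj); apply/subset_leq_card/subsetP => e.
  move=> /imsetP[y]; rewrite inE /= => /andP[_ xy] ->.
  rewrite inE set21 andbT; apply/imset2P.
  by exists x y; rewrite // !inE.
apply: (@leq_trans (\sum_x #|[set e in edges G | x \in e]|)).
  by apply: leq_sum.
under eq_bigr do rewrite -sum1dep_card.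
rewrite (exchange_big_dep (mem (edges G))) /=; last first.
  by move=> x e _ /andP[].
rewrite mulnC -sum_nat_const; apply: leq_sum => e eE.
rewrite sum1_card; apply: (@leq_trans #|e|).
  by apply: subset_leq_card; apply/subsetP => x; rewrite unfold_in => /andP[].
by case/imset2P: eE => x y _ _ ->; rewrite cards2; case: (_ != _).
Qed.

Lemma size_le_not_arrows (r : nat) (G : sgraph) :
  (2 * #|edges G| <= r ^ 2)%N -> ~ arrows r G (path_graph 4).
Proof.
move=> size_le arr.
have [|c [c_lt c_star]] := @star_coloring_exists G r setT.
  right; apply: leq_trans size_le; apply: leq_trans (sum_degree_le G).
  by apply: eq_leq; apply: eq_bigl => x; rewrite inE.
have [|f [k [f_inj fP]]] := arr c.
  by move=> e /imset2P[x y _]; rewrite !inE /= => xy ->; apply: c_lt.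
pose i0 : 'I_4 := @Ordinal 4 0 isT; pose i1 : 'I_4 := @Ordinal 4 1 isT.
pose i2 : 'I_4 := @Ordinal 4 2 isT; pose i3 : 'I_4 := @Ordinal 4 3 isT.
have [a01 c01] := fP i0 i1 isT; have [a12 c12] := fP i1 i2 isT.
have [a23 c23] := fP i2 i3 isT.
apply: (c_star (f i0) (f i1) (f i2) (f i3)); rewrite ?inE // ?(inj_eq f_inj) //.
  by rewrite c01 c12.
by rewrite c12 c23.
Qed.

(** * Degree sums in graphs without a path on four vertices *)

Section PathFree.
Variables (T : finType) (e : rel T).
Hypotheses (e_sym : symmetric e) (e_irr : irreflexive e).
Hypothesis e_free :
  forall a x y b, e a x -> e x y -> e y b -> ~ uniq [:: a; x; y; b].

Let deg x := #|[set y | e x y]|.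

(** If [x] has a neighbour [a] other than [y], then any neighbour [b] of [y] other than [x] must
    equal [a], or else [a x y b] would be a path. *)
Let deg_le2 x y : e x y -> (1 < deg x)%N -> (deg y <= 2)%N.
Proof.
move=> xy; rewrite /deg (cardsD1 y) inE xy ltnS => /card_gt0P[a].
rewrite !inE => /andP[ay xa].
rewrite (cardsD1 x) inE e_sym xy ltnS -(cards1 a).
apply/subset_leq_card/subsetP => b; rewrite !inE => /andP[bx yb].
apply: contraT => ba; case: (@e_free a x y b) => //; first by rewrite e_sym.
have neq u v : e u v -> u != v by apply: contraTneq => ->; rewrite e_irr.
by rewrite /= !inE !negb_or [a == x]eq_sym neq // ay [a == b]eq_sym ba neq //
  [x == b]eq_sym bx neq.
Qed.

(** Either an endpoint has degree 1 and contributes 1 alone, or both degrees are exactly 2 and the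
    halves add up to 1. *)
Let inv_deg_ge1 x y : e x y -> 1 <= (deg x)%:R^-1 + (deg y)%:R^-1 :> rat.
Proof.
move=> xy; have yx : e y x by rewrite e_sym.
have dx : (0 < deg x)%N by apply/card_gt0P; exists y; rewrite inE.
have dy : (0 < deg y)%N by apply/card_gt0P; exists x; rewrite inE.
have inv_ge0 z : 0 <= (deg z)%:R^-1 :> rat by rewrite invr_ge0 ler0n.
have [dx1|dx1] := leqP (deg x) 1.
  rewrite (_ : deg x = 1%N); last by lia.
  by rewrite mulr1n invr1 lerDl inv_ge0.
have [dy1|dy1] := leqP (deg y) 1.
  rewrite (_ : deg y = 1%N); last by lia.
  by rewrite mulr1n invr1 lerDr inv_ge0.
have -> : deg x = 2%N by apply/eqP; rewrite eqn_leq dx1 (@deg_le2 y x).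
have -> : deg y = 2%N by apply/eqP; rewrite eqn_leq dy1 (@deg_le2 x y).
by [].
Qed.

(** Sum [inv_deg_ge1] over ordered adjacent pairs. Each of the two terms totals at most [#|T|],
    since a vertex contributes 1, or 0 if isolated. *)
Lemma P4_free_sum_degree : (\sum_x #|[set y | e x y]| <= 2 * #|T|)%N.
Proof.
rewrite -(ler_nat rat) natr_sum.
have S1 : \sum_x \sum_(y | e x y) (deg x)%:R^-1 <= #|T|%:R :> rat.
  rewrite -sum1_card natr_sum; apply: ler_sum => x _.
  have -> : \sum_(y | e x y) (deg x)%:R^-1 = (deg x)%:R^-1 *+ deg x :> rat.
    by rewrite sumr_const /deg cardsE.
  have [->|d0] := eqVneq (deg x) 0%N; first by rewrite mulr0n ler01.
  by rewrite -[leLHS]mulr_natr mulVf // pnatr_eq0.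
have S2 : \sum_x \sum_(y | e x y) (deg y)%:R^-1 <= #|T|%:R :> rat.
  rewrite (exchange_big_dep xpredT) //=; apply: le_trans S1.
  rewrite le_eqVlt; apply/orP; left; apply/eqP.
  by apply: eq_bigr => x _; apply: eq_bigl => y; rewrite e_sym.
rewrite natrM mulr_natl mulr2n; apply: le_trans (lerD S1 S2).
rewrite -big_split /=; apply: ler_sum => x _.
rewrite -big_split /= -sum1_card natr_sum.
under eq_bigl do rewrite inE.
by apply: ler_sum => y; apply: inv_deg_ge1.
Qed.

End PathFree.

(** * Complete graphs and the upper bound *)

Lemma complete_adj_sym n : symmetric (fun x y : 'I_n => x != y).
Proof. by move=> x y; rewrite eq_sym. Qed.

Lemma complete_adj_irrefl n : irreflexive (fun x y : 'I_n => x != y).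
Proof. by move=> x; rewrite eqxx. Qed.

Definition complete_graph (n : nat) : sgraph :=
  @SGraph 'I_n _ (@complete_adj_sym n) (@complete_adj_irrefl n).

Lemma card_edges_complete (n : nat) :
  (#|edges (complete_graph n)| <= 'C(n, 2))%N.
Proof.
have <- : #|[set e : {set 'I_n} | #|e| == 2]| = 'C(n, 2).
  by rewrite card_draws card_ord.
apply/subset_leq_card/subsetP => e /imset2P[x y _]; rewrite !inE /= => xy ->.
by rewrite cards2 xy.
Qed.

(** Without a monochromatic path each colour class has degree sum at most [2 * n], but the [r]
    classes share all [n * n.-1] ordered pairs of distinct vertices. *)
Lemma complete_arrows (r n : nat) :
  (2 * r < n.-1)%N -> arrows r (complete_graph n) (path_graph 4).
Proof.
move=> lt_rn c c_lt; apply: contrapT => no_copy.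
pose e k : rel 'I_n := fun x y => (x != y) && (c [set x; y] == k).
have sum_le k : (\sum_x #|[set y | e k x y]| <= 2 * n)%N.
  rewrite -[X in (2 * X)%N]card_ord; apply: P4_free_sum_degree.
  - by move=> x y; rewrite /e eq_sym setUC.
  - by move=> x; rewrite /e eqxx.
  move=> a x y b /andP[ax /eqP cax] /andP[xy /eqP cxy] /andP[yb /eqP cyb] u.
  pose f (i : path_graph 4) : complete_graph n := nth a [:: a; x; y; b] i.
  have fP (i j : path_graph 4) :
      i.+1 == j :> nat -> adj (f i) (f j) /\ c [set f i; f j] = k.
    by case: i j => [[|[|[|[|i]]]] hi] // [[|[|[|[|j]]]] hj].
  apply: no_copy; exists f, k; split=> [i j /eqP|i j /orP[/fP//|/fP]].
    by rewrite nth_uniq // => /eqP /val_inj.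
  by rewrite adj_sym setUC.
have sum_ge : (n * n.-1 <= \sum_(k < r) \sum_x #|[set y | e k x y]|)%N.
  rewrite exchange_big /= -[X in (X * _)%N]card_ord -sum_nat_const.
  apply: leq_sum => x _.
  have -> : n.-1 = #|[set~ x]| by rewrite cardsC1 card_ord.
  under eq_bigr do rewrite -sum1_card big_mkcond.
  rewrite exchange_big -sum1_card big_mkcond /=; apply: leq_sum => y _.
  rewrite !inE; case: ifP => // yx.
  have xy : x != y by rewrite eq_sym yx.
  have ltc : (c [set x; y] < r)%N.
    by apply: c_lt; apply/imset2P; exists x y; rewrite ?inE.
  by rewrite (bigD1 (Ordinal ltc)) //= inE /e xy eqxx.
have : (\sum_(k < r) \sum_x #|[set y | e k x y]| <= r * (2 * n))%N.
  by rewrite -[X in (X * _)%N]card_ord -sum_nat_const; apply: leq_sum.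
by nia.
Qed.

Theorem theorem1p5 (r : nat) (hr : (2 <= r)%N) :
  (r%:R ^+ 2 / 2%:R < (size_ramsey r (path_graph 4))%:R :> rat) /\
  (size_ramsey r (path_graph 4) <= (r + 1) * (2 * r + 1))%N.
Proof.
(* [2 * r + 2] is the least order allowed by [complete_arrows], and ['C(2 * r + 2, 2)] equals
   [(r + 1) * (2 * r + 1)]. *)
have arrK : arrows r (complete_graph (2 * r + 2)) (path_graph 4).
  by apply: complete_arrows; lia.
have [[G [arrG sizeG]] min] := size_ramseyP arrK; split.
  rewrite ltr_pdivrMr ?ltr0n // -natrX -natrM ltr_nat mulnC ltnNge -sizeG.
  by apply/negP => /size_le_not_arrows; apply.
apply: leq_trans (min _ arrK) (leq_trans (card_edges_complete _) _).
by rewrite bin2; nia.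
Qed.
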